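(* Let $m$ be an odd positive integer, and let $N_{\rm E}(\mathbb{Z}_4,2m)$ denote the number of Euclidean self-dual cyclic codes of length $2m$ over $\mathbb{Z}_4$. Then $N_{\rm E}(\mathbb{Z}_4,2m)=1$ if and only if $m=1$.
   Context: A cyclic code of length $n$ over $\mathbb{Z}_4$ is a $\mathbb{Z}_4$-submodule of $\mathbb{Z}_4^n$ invariant under the cyclic shift (equivalently, an ideal of $\mathbb{Z}_4[X]/\langle X^n-1\rangle$). It is Euclidean self-dual if it equals its dual with respect to the form $\langle\boldsymbol{u},\boldsymbol{v}\rangle_{\rm E}=\sum_{i=0}^{n-1}u_iv_i$. *)

(* Defs.v *)
From HB Require Import structures.
From mathcomp Require Import all_boot all_algebra.

Set Implicit Arguments.
Unset Strict Implicit.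
Unset Printing Implicit Defensive.

Import GRing.Theory.
Local Open Scope ring_scope.

Definition is_submodule n (C : {set 'rV['Z_4]_n}) : bool :=
  (0 \in C) &&
  [forall a : 'Z_4, forall u in C, forall v in C, a *: u + v \in C].

Lemma is_submoduleP n (C : {set 'rV['Z_4]_n}) :
  reflect (submod_closed (mem C)) (is_submodule C).
Proof.
apply: (iffP andP) => [[C0 /forallP CL]|[C0 CL]]; split=> //.
- by move=> a u v Cu Cv; move/forall_inP/(_ u Cu)/forall_inP/(_ v Cv): (CL a).
- apply/forallP=> a; apply/forall_inP=> u Cu; apply/forall_inP=> v Cv.
  exact: CL.
Qed.

(* (u_0, u_1, ..., u_(n-1)) |-> (u_(n-1), u_0, ..., u_(n-2)) *)
Definition cyclic_shift n (u : 'rV['Z_4]_n) : 'rV['Z_4]_n :=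
  \row_(i < n) u 0 (ord_pred i).

Definition cyclic_code n (C : {set 'rV['Z_4]_n}) : bool :=
  is_submodule C && [forall u in C, cyclic_shift u \in C].

Definition euclidean_form n (u v : 'rV['Z_4]_n) : 'Z_4 :=
  \sum_(i < n) u 0 i * v 0 i.

Definition euclidean_dual n (C : {set 'rV['Z_4]_n}) : {set 'rV['Z_4]_n} :=
  [set v | [forall u in C, euclidean_form u v == 0]].

Definition euclidean_self_dual n (C : {set 'rV['Z_4]_n}) : bool :=
  C == euclidean_dual C.

Definition N_E (n : nat) : nat :=
  #|[set C : {set 'rV['Z_4]_n} | cyclic_code C && euclidean_self_dual C]|.

(* Main.v *)
(* Write m = 2q + 1 and let X be the shift on Z_4^(2m).  The code 2 Z_4^(2m) is
   always cyclic and self-dual, and for m = 1 every self-dual code lies in it,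
   since x^2 + y^2 = 0 in Z_4 forces x and y to be even.
   For q > 0 put h = X + ... + X^q and u = X^m.  Modulo 2,
   h + h^-1 is 1 minus the idempotent of the trivial character of Z/m, so on the
   complement of that character (u - 1) + 2h generates a self-dual ideal, which
   together with 2 on the trivial component gives a second self-dual cyclic code.
   Multiplying the generator by 1 + X telescopes h, leaving the parity check
   1 + X + X^m - X^(m+1) + 2 X^(3q+2). *)

Require Import Defs.
From mathcomp Require Import all_boot all_algebra ring zify.

Set Implicit Arguments.
Unset Strict Implicit.
Unset Printing Implicit Defensive.

Import GRing.Theory.
Local Open Scope ring_scope.

(** * Evenness and squares modulo 4 *)

Lemma Z4_four : 4 = 0 :> 'Z_4.
Proof. exact: val_inj. Qed.

(** Evenness is written [2 * x = 0]; a product of two even elements is a multiple of 4. *)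
Lemma Z4_even_mul (x y : 'Z_4) : 2 * x = 0 -> 2 * y = 0 -> x * y = 0.
Proof.
by case: x => [[|[|[|[|x]]]] hx] //; case: y => [[|[|[|[|y]]]] hy] //= /eqP h1 /eqP h2;
  apply: val_inj.
Qed.

Lemma Z4_evenP (x : 'Z_4) : 2 * x = 0 -> exists t : 'Z_4, x = 2 * t.
Proof.
case: x => [[|[|[|[|x]]]] hx] //= /eqP // _.
- by exists 0; apply: val_inj.
- by exists 1; apply: val_inj.
Qed.

(** Squares in ['Z_4] are 0 or 1, so two of them sum to 0 only when both are 0. *)
Lemma Z4_sum_sqr (x y : 'Z_4) : x * x + y * y = 0 -> 2 * x = 0 /\ 2 * y = 0.
Proof.
by case: x => [[|[|[|[|x]]]] hx] //; case: y => [[|[|[|[|y]]]] hy] //= /eqP // _;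
  split; apply: val_inj.
Qed.

Lemma Z4_double_opp (x : 'Z_4) : - (2 * x) = 2 * x.
Proof. by apply/eqP; rewrite eq_sym -addr_eq0 -mulrDl -natrD Z4_four mul0r. Qed.

(** * Words as periodic sequences, and the bilinear form *)

(** Reducing the index with [inZp] turns a word into a periodic sequence on the naturals, so that
    shifts become additions. *)
Definition coef N (v : 'rV['Z_4]_N.+1) (i : nat) : 'Z_4 := v 0 (inZp i).

Lemma coef_ord N (v : 'rV_N.+1) (i : 'I_N.+1) : coef v i = v 0 i.
Proof. by rewrite /coef valZpK. Qed.

Lemma coef_period N (v : 'rV_N.+1) i : coef v (i + N.+1) = coef v i.
Proof. by congr (v 0 _); apply: val_inj; rewrite /= modnDr. Qed.

Lemma coefD N (u v : 'rV_N.+1) i : coef (u + v) i = coef u i + coef v i.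
Proof. exact: mxE. Qed.

Lemma coefN N (v : 'rV_N.+1) i : coef (- v) i = - coef v i.
Proof. exact: mxE. Qed.

Lemma coefZ N a (v : 'rV_N.+1) i : coef (a *: v) i = a * coef v i.
Proof. exact: mxE. Qed.

Lemma coef_shift N (v : 'rV_N.+1) i : coef (cyclic_shift v) i = coef v (i + N).
Proof.
rewrite /coef mxE; congr (v 0 _); apply: val_inj => /=.
by rewrite addnS /= modnDml.
Qed.

Lemma euclidean_formE N (u v : 'rV_N.+1) :
  euclidean_form u v = \sum_(0 <= i < N.+1) coef u i * coef v i.
Proof. by rewrite big_mkord; apply: eq_bigr => i _; rewrite !coef_ord. Qed.

Lemma euclidean_formDl n (u v w : 'rV_n) :
  euclidean_form (u + v) w = euclidean_form u w + euclidean_form v w.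
Proof. by rewrite -big_split; apply: eq_bigr => i _; rewrite mxE mulrDl. Qed.

Lemma euclidean_formZl n a (u w : 'rV_n) :
  euclidean_form (a *: u) w = a * euclidean_form u w.
Proof. by rewrite mulr_sumr; apply: eq_bigr => i _; rewrite mxE mulrA. Qed.

Lemma euclidean_formNl n (u w : 'rV_n) : euclidean_form (- u) w = - euclidean_form u w.
Proof. by rewrite -scaleN1r euclidean_formZl mulN1r. Qed.

Lemma euclidean_form_suml n (I : Type) (r : seq I) (F : I -> 'rV_n) w :
  euclidean_form (\sum_(i <- r) F i) w = \sum_(i <- r) euclidean_form (F i) w.
Proof.
apply: (big_morph (fun u => euclidean_form u w)).
  by move=> u v; exact: euclidean_formDl.
by apply: big1 => i _; rewrite mxE mul0r.
Qed.

Definition unit_vec N (k : nat) : 'rV['Z_4]_N.+1 := delta_mx 0 (inZp k).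

Lemma euclidean_form_unit N k (w : 'rV_N.+1) :
  euclidean_form (unit_vec N k) w = coef w k.
Proof.
rewrite /euclidean_form (bigD1 (inZp k)) //= mxE !eqxx mul1r big1 ?addr0 //.
by move=> i ne; rewrite mxE (negPf ne) andbF mul0r.
Qed.

Lemma coef_unit N k i :
  coef (unit_vec N k) i = (i == k %[mod N.+1])%:R.
Proof. by rewrite /coef mxE eqxx. Qed.

(** * The code of even words, and length 2 *)

Definition even_code n : {set 'rV['Z_4]_n} := [set v | 2 *: v == 0].

Lemma even_codeP n (v : 'rV_n) :
  reflect (forall i, 2 * v 0 i = 0) (v \in even_code n).
Proof.
rewrite inE; apply: (iffP eqP) => [h i|h].
  by have /rowP/(_ i) := h; rewrite !mxE.
by apply/rowP => i; rewrite !mxE h.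
Qed.

Lemma even_code_cyclic n : cyclic_code (even_code n).
Proof.
apply/andP; split; last first.
  by apply/forall_inP => u /even_codeP h; apply/even_codeP => i; rewrite mxE.
apply/is_submoduleP; split; first by apply/even_codeP => i; rewrite mxE mulr0.
move=> a u v /even_codeP hu /even_codeP hv; apply/even_codeP => i.
by rewrite !mxE mulrDr mulrCA hu hv mulr0 addr0.
Qed.

(** The doubled unit vectors lie in the code and test each coordinate for evenness, which gives the
    harder inclusion. *)
Lemma even_code_self_dual n : euclidean_self_dual (even_code n).
Proof.
apply/eqP/setP => w; rewrite [RHS]inE; apply/even_codeP/forall_inP.
  move=> hw u /even_codeP hu; apply/eqP/big1 => i _.
  exact: Z4_even_mul.
case: n w => [w _ []|n w hw i] //.
have : 2 *: unit_vec n i \in even_code n.+1.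
  by rewrite inE scalerA -natrM Z4_four scale0r.
by move/hw; rewrite euclidean_formZl euclidean_form_unit coef_ord => /eqP.
Qed.

Lemma N_E_2 : N_E 2 = 1%N.
Proof.
apply: etrans (cards1 (even_code 2)); apply: eq_card => C.
rewrite !inE; apply/andP/eqP => [[_ /eqP sdC]|->]; last first.
  by rewrite even_code_cyclic even_code_self_dual.
have sub : C \subset even_code 2.
  apply/subsetP => u Cu; apply/even_codeP.
  have : u \in euclidean_dual C by rewrite -sdC.
  rewrite inE => /forall_inP/(_ _ Cu)/eqP.
  rewrite /euclidean_form !big_ord_recl big_ord0 addr0 => /Z4_sum_sqr [h0 h1].
  case=> [[|[|i]] hi] //; [rewrite -[RHS]h0|rewrite -[RHS]h1];
    by congr (2 * u 0 _); apply: val_inj.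
(* Duality reverses the inclusion [sub], and both codes are their own duals. *)
apply/eqP; rewrite eqEsubset sub /= (eqP (even_code_self_dual 2)) sdC.
apply/subsetP => w; rewrite !inE => /forall_inP h; apply/forall_inP => u Cu.
by apply: h; apply: (subsetP sub).
Qed.

(** * Sums of periodic sequences *)

Lemma sum_period (V : nmodType) (n s : nat) (h : nat -> V) :
    (forall i, h (i + n)%N = h i) ->
  \sum_(0 <= i < n) h (i + s)%N = \sum_(0 <= i < n) h i.
Proof.
move=> hP; elim: s => [|s IH]; first by apply: eq_bigr => i _; rewrite addn0.
rewrite -IH; case: n hP {IH} => [|n] hP; first by rewrite !big_geq.
rewrite [RHS]big_nat_recl // big_nat_recr //= addrC; congr (_ + _).
  by rewrite -(hP (0 + s)%N); congr h; lia.
by apply: eq_bigr => i _; congr h; lia.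
Qed.

Lemma sum_two_halves (V : nmodType) (m : nat) (h : nat -> V) :
  \sum_(0 <= i < m) (h i + h (i + m)%N) = \sum_(0 <= i < m + m) h i.
Proof.
rewrite big_split [RHS](@big_cat_nat _ _ _ m) ?leq_addr //=; congr (_ + _).
by rewrite -{3}[m]add0n big_addn addnK.
Qed.

(** * Twisted sequences and their orthogonality *)

(** With m = 2q + 1, the first two conditions are congruences modulo 2: windows of length m have
    even sum, and [f] has period m. The third is the parity check modulo 4. *)
Definition twisted q (f : nat -> 'Z_4) : Prop := forall k,
  [/\ 2 * \sum_(0 <= j < 2 * q + 1) f (k + j)%N = 0,
      2 * (f k + f (k + (2 * q + 1))%N) = 0 &
      f k + f (k + 1)%N + f (k + (2 * q + 1))%N - f (k + (2 * q + 2))%N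
        + 2 * f (k + (3 * q + 2))%N = 0].

Section Twisted.
Variables (q : nat) (f : nat -> 'Z_4).
Hypothesis ft : twisted q f.

Lemma twisted_double_period k : 2 * f (k + (2 * q + 1))%N = 2 * f k.
Proof.
have [_ h _] := ft k.
rewrite -[RHS]Z4_double_opp; apply/eqP.
by rewrite -addr_eq0 -mulrDr addrC h.
Qed.

(** Given period m modulo 2, the third condition says that [E] below is constant; the second makes
    this constant even, hence of the form [2 * t]. *)
Lemma twisted_fold : exists t, forall k,
  f k + f (k + (2 * q + 1))%N = 2 * (\sum_(0 <= j < q) f (k + j.+1)%N + t).
Proof.
pose E k := f k + f (k + (2 * q + 1))%N - 2 * \sum_(0 <= j < q) f (k + j.+1)%N.
have E1 k : E k.+1 = E k.
  have tele : \sum_(0 <= j < q) f (k.+1 + j.+1)%N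
            = \sum_(0 <= j < q) f (k + j.+1)%N + f (k + q.+1)%N - f k.+1.
    apply/eqP; rewrite eq_sym subr_eq; apply/eqP.
    rewrite -(@big_nat_recr _ _ _ q 0 (fun j => f (k + j.+1)%N)) //=.
    rewrite big_nat_recl //= addn1 addrC; congr (_ + _); apply: eq_bigr => j _.
    by rewrite addSnnS.
  have [_ _ h] := ft k.
  have p := twisted_double_period (k + q.+1).
  rewrite (_ : k + q.+1 + _ = k + (3 * q + 2))%N in p; last lia.
  rewrite /E (_ : k.+1 + (2 * q + 1) = k + (2 * q + 2))%N; last lia.
  rewrite tele; rewrite addn1 in h.
  (* Adding the vanishing parity check [h] leaves a multiple of 4 and a difference that [p]
     cancels. *)
  apply/eqP; rewrite -subr_eq0 -[_ - _]addr0 -[X in _ + X]h; apply/eqP.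
  transitivity (4 * f k.+1 + (2 * f (k + (3 * q + 2))%N - 2 * f (k + q.+1)%N)).
    by ring.
  by rewrite p Z4_four; ring.
have EE k : E k = E 0%N by elim: k => // k <-.
have /Z4_evenP[t Et] : 2 * E 0%N = 0.
  by have [_ h _] := ft 0; rewrite /E mulrBr h mulrA -natrM Z4_four; ring.
by exists t => k; rewrite mulrDr -Et -(EE k) /E; ring.
Qed.

End Twisted.

(* Folding the sum over [Z/2m] onto [Z/m] turns it into
   [2 \sum_i f i (\sum_(l < m) g (i + l))]: the two half-range convolutions
   produced by [twisted_fold] are reindexed into the two halves of [1, 2q]. *)
Lemma twisted_orthogonal q (f g : nat -> 'Z_4) :
    twisted q f -> twisted q g ->
  \sum_(0 <= i < (2 * q + 1) + (2 * q + 1)) f i * g i = 0.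
Proof.
move=> ft gt; have [s fs] := twisted_fold ft; have [t gs] := twisted_fold gt.
have fp := twisted_double_period ft; have gp := twisted_double_period gt.
pose F i := \sum_(0 <= j < q) f (i + j.+1)%N.
pose G i := \sum_(0 <= j < q) g (i + j.+1)%N.
rewrite -(@sum_two_halves _ _ (fun i => f i * g i)).
rewrite (eq_bigr (fun i => 2 * (f i * (g i + G i)) + 2 * (g i * F i)
                           + (2 * f i * t + 2 * g i * s))); last first.
  move=> i _; have := fs i; have := gs i; rewrite -/(F i) -/(G i) => hg hf.
  have -> : f (i + (2 * q + 1))%N = 2 * (F i + s) - f i by rewrite -hf; ring.
  have -> : g (i + (2 * q + 1))%N = 2 * (G i + t) - g i by rewrite -hg; ring.
  apply/eqP; rewrite -subr_eq0; apply/eqP.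
  transitivity (4 * ((F i + s) * (G i + t) - g i * (F i + s) - f i * (G i + t))).
    by ring.
  by rewrite Z4_four mul0r.
rewrite !big_split /= -!mulr_suml -!mulr_sumr.
(* The constants [s] and [t] multiply doubled window sums, which vanish by the first condition. *)
have [/= f0 _ _] := ft 0%N; have [/= g0 _ _] := gt 0%N.
rewrite f0 g0 !mul0r !addr0.
have -> : 2 * (\sum_(0 <= i < 2 * q + 1) g i * F i)
  = \sum_(0 <= i < 2 * q + 1)
      2 * (f i * \sum_(q.+1 <= l < 2 * q + 1) g (i + l)%N).
  rewrite mulr_sumr.
  under eq_bigr => i _ do rewrite mulr_sumr mulr_sumr.
  under [RHS]eq_bigr => i _ do rewrite mulr_sumr mulr_sumr.
  rewrite exchange_big_nat [RHS]exchange_big_nat /=.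
  (* The indices are matched by l = 2q - j: translating [i] by 2q - j sends i + j + 1 to i + m, and
     doubled values have period m. *)
  rewrite [RHS]big_nat_rev /= -[X in _ = \big[_/_]_(X <= _ < _) _]add0n big_addn.
  have -> : (2 * q + 1 - q.+1 = q)%N by lia.
  rewrite !big_nat; apply: eq_bigr => j /andP[_ jq].
  rewrite -(@sum_period _ _ (2 * q - j)); last first.
    move=> i; rewrite mulrCA addnAC fp mulrCA mulrA gp; ring.
  apply: eq_bigr => i _.
  have -> : (i + (2 * q - j) + j.+1 = i + (2 * q + 1))%N by lia.
  have -> : (q.+1 + (2 * q + 1) - (j + q.+1).+1 = 2 * q - j)%N by lia.
  by rewrite mulrCA fp; ring.
rewrite mulr_sumr -big_split big1 //= => i _.
have [gi _ _] := gt i.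
rewrite -mulrDr -mulrDr -addrA mulrCA; apply: etrans (mulr0 (f i)); congr (_ * _).
rewrite -[RHS]gi; congr (_ * _).
rewrite [RHS](@big_cat_nat _ _ _ q.+1) //=; last by lia.
by rewrite big_nat_recl // addn0 addrA.
Qed.

(** * Constructions of twisted sequences *)

(** The reciprocal parity check: the exponents in the third condition of [twisted] are negated
    modulo 4q + 2. *)
Definition wave q (e : nat -> 'Z_4) (i : nat) : 'Z_4 :=
  e i + e (i + (4 * q + 1))%N + e (i + (2 * q + 1))%N - e (i + 2 * q)%N
    + 2 * e (i + q)%N.

Lemma sum_full_period q (e : nat -> 'Z_4) k :
    (forall i, e (i + (4 * q + 1).+1)%N = e i) ->
  \sum_(0 <= i < 2 * q + 1) (e (i + k)%N + e (i + k + (2 * q + 1))%N)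
    = \sum_(0 <= i < (4 * q + 1).+1) e i.
Proof.
move=> eP; rewrite -[RHS](@sum_period _ _ k) //.
have -> : ((4 * q + 1).+1 = 2 * q + 1 + (2 * q + 1))%N by lia.
rewrite -sum_two_halves; apply: eq_bigr => i _.
by rewrite (addnAC i k).
Qed.

(* The parity check annihilates its own reciprocal applied to any periodic [e]:
   the products of monomials cancel modulo 4. *)
Lemma twisted_wave q (e : nat -> 'Z_4) :
  (forall i, e (i + (4 * q + 1).+1)%N = e i) -> twisted q (wave q e).
Proof.
move=> eP k; split; rewrite /wave.
- rewrite mulr_sumr.
  (* Doubling kills the last term and the sign; the other four terms form two pairs at distance m,
     each summing to a full period. *)
  rewrite (eq_bigr (fun i => 2 * (e (i + k)%N + e (i + k + (2 * q + 1))%N)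
     + 2 * (e (i + (k + 4 * q + 1))%N + e (i + (k + 4 * q + 1) + (2 * q + 1))%N))).
    rewrite big_split /= -!mulr_sumr !sum_full_period //.
    by rewrite -mulrDl -natrD Z4_four mul0r.
  move=> i _.
  rewrite (addnC k i) (_ : i + (k + 4 * q + 1) = i + k + (4 * q + 1))%N; last lia.
  rewrite (_ : i + k + (4 * q + 1) + (2 * q + 1) = i + k + 2 * q + (4 * q + 1).+1)%N;
    last lia.
  rewrite eP; apply/eqP; rewrite -subr_eq0; apply/eqP.
  transitivity (4 * (e (i + k + q)%N - e (i + k + 2 * q)%N)); first by ring.
  by rewrite Z4_four mul0r.
- rewrite (_ : k + (2 * q + 1) + (4 * q + 1) = k + 2 * q + (4 * q + 1).+1)%N; last lia.
  rewrite (_ : k + (2 * q + 1) + (2 * q + 1) = k + (4 * q + 1).+1)%N; last lia.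
  rewrite (_ : k + (2 * q + 1) + 2 * q = k + (4 * q + 1))%N; last lia.
  rewrite !eP.
  transitivity (4 * (e k + e (k + (2 * q + 1))%N + e (k + q)%N
    + e (k + (2 * q + 1) + q)%N)); first by ring.
  by rewrite Z4_four mul0r.
- rewrite (_ : k + 1 + (4 * q + 1) = k + (4 * q + 1).+1)%N; last lia.
  rewrite (_ : k + 1 + (2 * q + 1) = k + (2 * q + 2))%N; last lia.
  rewrite (_ : k + 1 + 2 * q = k + (2 * q + 1))%N; last lia.
  rewrite (_ : k + (2 * q + 1) + (4 * q + 1) = k + 2 * q + (4 * q + 1).+1)%N; last lia.
  rewrite (_ : k + (2 * q + 1) + (2 * q + 1) = k + (4 * q + 1).+1)%N; last lia.
  rewrite (_ : k + (2 * q + 1) + 2 * q = k + (4 * q + 1))%N; last lia.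
  rewrite (_ : k + (2 * q + 1) + q = k + (3 * q + 1))%N; last lia.
  rewrite (_ : k + (2 * q + 2) + (4 * q + 1) = k + (2 * q + 1) + (4 * q + 1).+1)%N;
    last lia.
  rewrite (_ : k + (2 * q + 2) + (2 * q + 1) = k + 1 + (4 * q + 1).+1)%N; last lia.
  rewrite (_ : k + (2 * q + 2) + 2 * q = k + (4 * q + 1).+1)%N; last lia.
  rewrite (_ : k + (2 * q + 2) + q = k + (3 * q + 2))%N; last lia.
  rewrite (_ : k + (3 * q + 2) + (4 * q + 1) = k + (3 * q + 1) + (4 * q + 1).+1)%N;
    last lia.
  rewrite (_ : k + (3 * q + 2) + (2 * q + 1) = k + 1 + q + (4 * q + 1).+1)%N; last lia.
  rewrite (_ : k + (3 * q + 2) + 2 * q = k + q + (4 * q + 1).+1)%N; last lia.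
  rewrite (_ : k + (3 * q + 2) + q = k + (4 * q + 1).+1)%N; last lia.
  rewrite !eP.
  transitivity (4 * (2 * e k + e (k + 1 + q)%N + e (k + (3 * q + 1))%N));
    first by ring.
  by rewrite Z4_four mul0r.
Qed.

(** Doubling makes the first two conditions vanish modulo 4; in the third, the sign and the last
    term disappear, leaving the hypothesis. *)
Lemma twisted_double q (f : nat -> 'Z_4) :
    (forall k, 2 * (f (k + 1)%N + f (k + 1 + (2 * q + 1))%N)
               = 2 * (f k + f (k + (2 * q + 1))%N)) ->
  twisted q (fun i => 2 * f i).
Proof.
move=> fD k; split.
- by rewrite -mulr_sumr mulrA -natrM Z4_four mul0r.
- by rewrite -mulrDr mulrA -natrM Z4_four mul0r.
have e : 2 * f (k + (2 * q + 2))%N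
       = 2 * (f k + f (k + (2 * q + 1))%N) - 2 * f (k + 1)%N.
  rewrite -fD mulrDr addrC addKr; congr (_ * f _); lia.
rewrite e; transitivity (4 * (f (k + 1)%N + f (k + (3 * q + 2))%N)); first by ring.
by rewrite Z4_four mul0r.
Qed.

(** * The twisted code and its self-duality *)

(** Letting [k] range over one period keeps the predicate boolean; periodicity recovers all
    naturals. *)
Definition twisted_code q : {set 'rV['Z_4]_(4 * q + 1).+1} :=
  [set v | [forall k : 'I_(4 * q + 1).+1,
    [&& 2 * \sum_(0 <= j < 2 * q + 1) coef v (k + j)%N == 0,
        2 * (coef v k + coef v (k + (2 * q + 1))%N) == 0 &
        coef v k + coef v (k + 1)%N + coef v (k + (2 * q + 1))%N
          - coef v (k + (2 * q + 2))%N + 2 * coef v (k + (3 * q + 2))%N == 0]]].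

Lemma coef_mod N (v : 'rV_N.+1) k i : coef v (k %% N.+1 + i) = coef v (k + i).
Proof. by congr (v 0 _); apply: val_inj; rewrite /= modnDml. Qed.

Lemma twisted_codeP q (v : 'rV_(4 * q + 1).+1) :
  reflect (twisted q (coef v)) (v \in twisted_code q).
Proof.
rewrite inE; apply: (iffP forallP) => [h k|h k].
  have /and3P[/eqP h1 /eqP h2 /eqP h3] := h (inZp k); move: h1 h2 h3 => /=.
  rewrite -[X in coef v X + _]addn0 -[X in coef v X + coef v (_ + 1)]addn0.
  under eq_bigr => j _ do rewrite coef_mod.
  by rewrite !coef_mod !addn0.
by have [-> -> ->] := h k; rewrite eqxx.
Qed.

Lemma twisted_code_cyclic q : cyclic_code (twisted_code q).
Proof.
apply/andP; split.
  apply/is_submoduleP; split.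
    apply/twisted_codeP => k; rewrite /coef !mxE; split.
    - by rewrite big1 ?mulr0 // => j _; rewrite mxE.
    - by rewrite !addr0 mulr0.
    - by rewrite mulr0 oppr0 !addr0.
  move=> a u v /twisted_codeP hu /twisted_codeP hv; apply/twisted_codeP => k.
  have [hu1 hu2 hu3] := hu k; have [hv1 hv2 hv3] := hv k; split.
  - under eq_bigr => j _ do rewrite coefD coefZ.
    by rewrite big_split -mulr_sumr mulrDr mulrCA hu1 hv1 mulr0 addr0.
  - transitivity (a * (2 * (coef u k + coef u (k + (2 * q + 1))%N))
      + 2 * (coef v k + coef v (k + (2 * q + 1))%N)).
      by rewrite !(coefD, coefZ); ring.
    by rewrite hu2 hv2 mulr0 addr0.
  - rewrite -[RHS]hv3 -[RHS]add0r -(mulr0 a) -hu3 !(coefD, coefZ); ring.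
apply/forall_inP => v /twisted_codeP h; apply/twisted_codeP => k.
(* This index is k - 1 modulo the length, undoing the delay of the shift. *)
have [h1 h2 h3] := h (k + (4 * q + 1))%N.
rewrite !coef_shift -![(k + _ + (4 * q + 1))%N]addnAC; split=> //.
by under eq_bigr => j _ do rewrite coef_shift addnAC.
Qed.

(** Here [b] represents -a modulo the length: moving the unit forward amounts to reading from an
    earlier position. *)
Lemma coef_unit_shift N k i a b :
    (N.+1 %| a + b)%N ->
  coef (unit_vec N (k + a)) i = coef (unit_vec N k) (i + b).
Proof.
move=> /dvdnP[c ab]; rewrite !coef_unit -(eqn_modDr b) -addnA ab.
by rewrite [(k + _)%N]addnC modnMDl.
Qed.

(** Pairing with this word and the next two evaluates the three expressions of [twisted] at [k].
    Once they are codewords, every word of the dual is twisted. *)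
Definition window_word q k : 'rV['Z_4]_(4 * q + 1).+1 :=
  2 *: \sum_(0 <= j < 2 * q + 1) unit_vec _ (k + j).

Definition pair_word q k : 'rV['Z_4]_(4 * q + 1).+1 :=
  2 *: (unit_vec _ k + unit_vec _ (k + (2 * q + 1))).

Definition wave_word q k : 'rV['Z_4]_(4 * q + 1).+1 :=
  unit_vec _ k + unit_vec _ (k + 1) + unit_vec _ (k + (2 * q + 1))
    - unit_vec _ (k + (2 * q + 2)) + 2 *: unit_vec _ (k + (3 * q + 2)).

Lemma eq_twisted q (f g : nat -> 'Z_4) : f =1 g -> twisted q f -> twisted q g.
Proof.
move=> fg ft k; have [h1 h2 h3] := ft k; rewrite -!fg; split=> //.
by under eq_bigr => j _ do rewrite -fg.
Qed.

(** Two windows at distance m tile a full period, so the sum in [twisted_double] is the same at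
    every index. *)
Lemma window_word_in q k : window_word q k \in twisted_code q.
Proof.
pose e i j := coef (unit_vec (4 * q + 1) (k + j)) i.
pose F i := \sum_(0 <= j < 2 * q + 1) e i j.
have FE i : F i + F (i + (2 * q + 1))%N = \sum_(0 <= j < (4 * q + 1).+1) e i j.
  rewrite -big_split /= (_ : (4 * q + 1).+1 = 2 * q + 1 + (2 * q + 1))%N; last lia.
  rewrite -sum_two_halves; apply: eq_bigr => j _; congr (_ + _).
  rewrite /e [(k + (j + _))%N]addnA -(@coef_unit_shift _ _ _ (2 * q + 1)) //.
  by apply/dvdnP; exists 1%N; lia.
apply/twisted_codeP/(@eq_twisted _ (fun i => 2 * F i)).
  by move=> i; rewrite /coef mxE summxE.
apply: twisted_double => i; rewrite !FE; congr (_ * _).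
rewrite -[LHS](@sum_period _ _ 1); last first.
  move=> j; rewrite /e [(k + (j + _))%N]addnA.
  by rewrite (@coef_unit_shift _ _ _ _ 0) ?addn0.
apply: eq_bigr => j _; rewrite /e [(k + (j + _))%N]addnA.
by rewrite (@coef_unit_shift _ _ _ _ (4 * q + 1)) ?add1n // -addnA add1n coef_period.
Qed.

(** The pair is invariant under translation by m, so both sides of the condition in [twisted_double]
    are multiples of 4. *)
Lemma pair_word_in q k : pair_word q k \in twisted_code q.
Proof.
pose e i := coef (unit_vec (4 * q + 1) k) i.
apply/twisted_codeP/(@eq_twisted _ (fun i => 2 * (e i + e (i + (2 * q + 1))%N))).
  move=> i; rewrite coefZ coefD; congr (_ * (_ + _)).
  by rewrite /e -(@coef_unit_shift _ _ _ (2 * q + 1)) //; apply/dvdnP; exists 1%N; lia.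
apply: twisted_double => i.
have eP j : e (j + (2 * q + 1) + (2 * q + 1))%N = e j.
  rewrite /e -[RHS]coef_period; congr coef; lia.
rewrite !eP; transitivity (4 * (e (i + 1)%N + e (i + 1 + (2 * q + 1))%N)).
  by ring.
rewrite Z4_four mul0r; apply/esym.
transitivity (4 * (e i + e (i + (2 * q + 1))%N)); first by ring.
by rewrite Z4_four mul0r.
Qed.

Lemma wave_word_in q k : wave_word q k \in twisted_code q.
Proof.
pose e i := coef (unit_vec (4 * q + 1) k) i.
apply/twisted_codeP/(@eq_twisted _ (wave q e)); last first.
  by apply: twisted_wave => i; rewrite /e coef_period.
move=> i; rewrite !(coefD, coefN, coefZ) /wave /e.
have sh := @coef_unit_shift (4 * q + 1) k i.
rewrite (sh 1 (4 * q + 1))%N ?(sh (2 * q + 1) (2 * q + 1))%N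
  ?(sh (2 * q + 2) (2 * q))%N ?(sh (3 * q + 2) q)%N //;
  by apply/dvdnP; exists 1%N; lia.
Qed.

Lemma twisted_code_self_dual q : euclidean_self_dual (twisted_code q).
Proof.
apply/eqP/setP => w; rewrite [RHS]inE; apply/idP/forall_inP.
  move=> /twisted_codeP hw u /twisted_codeP hu; apply/eqP.
  rewrite euclidean_formE (_ : (4 * q + 1).+1 = 2 * q + 1 + (2 * q + 1))%N; last lia.
  exact: twisted_orthogonal.
move=> hw; apply/twisted_codeP => k; split.
- have /hw/eqP h := window_word_in q k; rewrite -[RHS]h.
  rewrite euclidean_formZl euclidean_form_suml; congr (_ * _).
  by apply: eq_bigr => j _; rewrite euclidean_form_unit.
- have /hw/eqP h := pair_word_in q k; rewrite -[RHS]h.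
  by rewrite euclidean_formZl euclidean_formDl !euclidean_form_unit.
- have /hw/eqP h := wave_word_in q k; rewrite -[RHS]h.
  by rewrite !(euclidean_formDl, euclidean_formNl, euclidean_formZl)
    !euclidean_form_unit.
Qed.

(** * Two distinct codes for m > 1 *)

Lemma twisted_code_neq_even q : (0 < q)%N -> twisted_code q != even_code _.
Proof.
move=> q0; apply/eqP => eq_code.
have : wave_word q 0 \in even_code _ by rewrite -eq_code wave_word_in.
move/even_codeP/(_ (inZp 0)); rewrite -[wave_word _ _ _ _]/(coef _ 0).
have c0 i : (0 < i < (4 * q + 1).+1)%N -> coef (unit_vec (4 * q + 1) i) 0 = 0.
  case/andP=> i0 iq; rewrite coef_unit mod0n modn_small //.
  by rewrite eq_sym (negPf (lt0n_neq0 i0)).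
have -> : coef (wave_word q 0) 0 = 1.
  have c00 : coef (unit_vec (4 * q + 1) 0) 0 = 1 by rewrite coef_unit eqxx.
  (* The other four positions must lie strictly between 0 and 4q + 2; for 2q + 2 and 3q + 2 this is
     where [0 < q] enters. *)
  rewrite !(coefD, coefN, coefZ) c00 !c0; [by ring | lia..].
by move/eqP.
Qed.

Local Close Scope ring_scope.

Theorem corollary4p10 (m : nat) (hm : odd m) : N_E (2 * m) = 1 <-> m = 1.
Proof.
split=> [|->]; last exact: N_E_2.
have := odd_double_half m; rewrite hm => mE.
(* Here [m./2] plays the role of q, and the case of zero is exactly m = 1. *)
have [q0|q0] := posnP m./2; first by rewrite -mE q0.
have -> : (2 * m = (4 * m./2 + 1).+1)%N by lia.
move/eqP/cards1P => [C CE].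
have : even_code (4 * m./2 + 1).+1 \in [set C].
  by rewrite -CE inE even_code_cyclic even_code_self_dual.
have : twisted_code m./2 \in [set C].
  by rewrite -CE inE twisted_code_cyclic twisted_code_self_dual.
rewrite !inE => /eqP <- /eqP /esym/eqP.
by rewrite (negPf (twisted_code_neq_even q0)).
Qed.
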